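(* Let $P_{XZ}$ be a joint distribution on a finite alphabet $\mathsf{X}\times\mathsf{Z}$, let $\mathsf{Y}$ be a finite reconstruction alphabet, and let $W_{X|YZ}$ be a conditional distribution of $X$ given $(Y,Z)$ (the posterior channel). Suppose there exist a finite alphabet $\mathsf{U}$ and conditional PMFs $P_{U|X}$ and $P_{Y|UZ}$ such that the joint distribution $$P_{UXYZ}(u,x,y,z):=P_{XZ}(x,z)P_{U|X}(u|x)P_{Y|UZ}(y|u,z)$$ satisfies: its induced conditional $P_{X|YZ}(x|y,z)=W_{X|YZ}(x|y,z)$ for all $(x,y,z)$ with $P_{YZ}(y,z)>0$; $Z-X-U$, $X-(U,Z)-Y$ and $X-(Y,Z)-U$ are Markov chains under $P_{UXYZ}$; and $R\ge I(X;U)-I(U;Z)$, where the mutual informations are computed under $P_{UXYZ}$. Then $R$ is an achievable rate (in the sense defined in the context) for $(P_{XZ},\mathsf{Y},W_{X|YZ})$.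
   Context: An $(n,\Theta)$ lossy source compression protocol with classical side information consists of a randomized encoder $\mathcal{E}^{(n)}(m|x^n)$, a conditional PMF on $[\Theta]=\{1,\dots,\Theta\}$ given $x^n\in\mathsf{X}^n$, and a randomized decoder $\mathcal{D}^{(n)}(y^n|m,z^n)$, a conditional PMF on $\mathsf{Y}^n$ given $(m,z^n)\in[\Theta]\times\mathsf{Z}^n$. It induces $$P_{X^nY^nZ^n}(x^n,y^n,z^n)=P_{XZ}^n(x^n,z^n)\sum_{m\in[\Theta]}\mathcal{E}^{(n)}(m|x^n)\mathcal{D}^{(n)}(y^n|m,z^n),$$ where $P_{XZ}^n$ is the $n$-fold i.i.d. product. With $P_{Y^nZ^n}$ its marginal and $W^n_{X|YZ}(x^n|y^n,z^n)=\prod_{i=1}^nW_{X|YZ}(x_i|y_i,z_i)$, the error is $\Xi:=\|P_{X^nY^nZ^n}-P_{Y^nZ^n}W^n_{X|YZ}\|_{\mathrm{TV}}$ (total variation distance). A rate $R$ is achievable if for every $\epsilon>0$ and all sufficiently large $n$ there exists an $(n,\Theta)$ protocol with $\frac1n\log\Theta\le R+\epsilon$ and $\Xi\le\epsilon$. *)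

(* Defs.v *)
From mathcomp Require Import all_boot all_order all_algebra.
From mathcomp Require Import reals exp.
Set Implicit Arguments. Unset Strict Implicit. Unset Printing Implicit Defensive.
Import Order.TTheory GRing.Theory Num.Theory.
Local Open Scope ring_scope.

Section Defs.
Variable R : realType.

Definition is_pmf (A : finType) (p : A -> R) : Prop :=
  (forall a, 0 <= p a) /\ \sum_a p a = 1.

Definition is_cpmf (A B : finType) (K : A -> B -> R) : Prop :=
  forall a, is_pmf (K a).

Definition mutual_info (A B : finType) (p : A -> B -> R) : R :=
  \sum_a \sum_b
    (if 0 < p a b then
       p a b * ln (p a b / ((\sum_b' p a b') * (\sum_a' p a' b)))
     else 0).

Definition markov_chain (A B C : finType) (p : A -> B -> C -> R) : Prop :=
  forall a b c,
    0 < \sum_a' \sum_c' p a' b c' ->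
    p a b c / (\sum_a' \sum_c' p a' b c') =
      ((\sum_c' p a b c') / (\sum_a' \sum_c' p a' b c')) *
      ((\sum_a' p a' b c) / (\sum_a' \sum_c' p a' b c')).

Definition joint_UXYZ (X Y Z U : finType) (PXZ : X -> Z -> R)
  (PUX : X -> U -> R) (PYUZ : U * Z -> Y -> R) (u : U) (x : X) (y : Y) (z : Z) : R :=
  PXZ x z * PUX x u * PYUZ (u, z) y.

(* Induced joint distribution P_{X^n Y^n Z^n} of an (n,Theta) protocol with
   encoder E(m|x^n) = E xs m and decoder D(y^n|m,z^n) = D (m, zs) ys. *)
Definition induced_joint (X Y Z : finType) (PXZ : X -> Z -> R) (n Theta : nat)
  (E : n.-tuple X -> 'I_Theta -> R) (D : 'I_Theta * n.-tuple Z -> n.-tuple Y -> R)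
  (xs : n.-tuple X) (ys : n.-tuple Y) (zs : n.-tuple Z) : R :=
  (\prod_(i < n) PXZ (tnth xs i) (tnth zs i)) *
  \sum_(m : 'I_Theta) E xs m * D (m, zs) ys.

(* Error Xi = || P_{X^nY^nZ^n} - P_{Y^nZ^n} W^n_{X|YZ} ||_TV,
   total variation = half the l1 distance. W (y,z) x = W_{X|YZ}(x|y,z). *)
Definition protocol_error (X Y Z : finType) (PXZ : X -> Z -> R)
  (W : Y * Z -> X -> R) (n Theta : nat)
  (E : n.-tuple X -> 'I_Theta -> R) (D : 'I_Theta * n.-tuple Z -> n.-tuple Y -> R) : R :=
  2^-1 * \sum_(xs : n.-tuple X) \sum_(ys : n.-tuple Y) \sum_(zs : n.-tuple Z)
    `| induced_joint PXZ E D xs ys zs -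
       (\sum_(xs' : n.-tuple X) induced_joint PXZ E D xs' ys zs) *
       \prod_(i < n) W (tnth ys i, tnth zs i) (tnth xs i) |.

Definition achievable_rate (X Y Z : finType) (PXZ : X -> Z -> R)
  (W : Y * Z -> X -> R) (Rt : R) : Prop :=
  forall eps : R, 0 < eps ->
  exists N : nat, forall n : nat, (N <= n)%N ->
  exists (Theta : nat) (E : n.-tuple X -> 'I_Theta -> R)
         (D : 'I_Theta * n.-tuple Z -> n.-tuple Y -> R),
    [/\ is_cpmf E, is_cpmf D,
        (n%:R)^-1 * ln (Theta%:R) <= Rt + eps &
        protocol_error PXZ W E D <= eps].

End Defs.

(* Main.v *)
(** Random coding with a likelihood encoder.  Draw codewords [c (m, l)] i.i.d. from [P_U].
Given [x], the encoder picks [(m, l)] with probability proportional to [P_{X|U}(x | c (m, l))]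
and sends [m]; given [z], the decoder looks for the [l] with [P_{Z|U}(z | c (m, l))] large
compared to [P_Z(z)] and applies [P_{Y|UZ}].  Compare with the idealised law in which [(m, l)] is
uniform and [X, Z, Y] are generated from the codeword: there the chain [X - (Y, Z) - U] makes
the posterior of [X] given [(Y, Z)] exactly [W].  The two laws are close because the number of
codewords exceeds [exp (n I(X;U))] (soft covering), while the number of values of [l] stays
below [exp (n I(U;Z))] (packing).  Both random-coding bounds are proved for arbitrary finite
alphabets, in terms of tails of the information densities, and the tails are controlled on
blocks by Chebyshev's inequality. *)
Require Import Defs.
From mathcomp Require Import all_boot all_order all_algebra.
From mathcomp Require Import boolp reals sequences exp.
From mathcomp Require Import ring lra.
Import Order.TTheory GRing.Theory Num.Theory.
Local Open Scope ring_scope.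

(** * Means over i.i.d. families *)

Lemma ffun_prod_factor {R : comNzRingType} {K A : finType} (p : A -> R)
  (h : K -> A -> R) :
  \sum_(c : {ffun K -> A}) (\prod_k p (c k)) * \prod_k h k (c k) =
  \prod_k \sum_a p a * h k a.
Proof.
rewrite bigA_distr_bigA /=; apply: eq_bigr => c _.
by rewrite -big_split.
Qed.

(** Writes a function of one coordinate as a product over all coordinates, the form that
    [ffun_prod_factor] turns into a product of means. *)
Lemma prod_if_eq {R : comNzRingType} {K : finType} (k : K) (f : K -> R) :
  \prod_j (if j == k then f j else 1) = f k.
Proof. by rewrite -big_mkcond big_pred1_eq. Qed.

Definition iid_mean {R : realType} {K A : finType} (p : A -> R)
  (F : {ffun K -> A} -> R) : R :=
  \sum_(c : {ffun K -> A}) (\prod_k p (c k)) * F c.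

Section IidMean.
Context {R : realType} {K A : finType} (p : A -> R) (hp : is_pmf p).
Local Notation Ex := (@iid_mean R K A p).

Lemma iid_mean_coord k (f : A -> R) :
  Ex (fun c => f (c k)) = \sum_a p a * f a.
Proof.
rewrite /iid_mean.
under eq_bigr => c _ do rewrite -(prod_if_eq k (fun j => f (c j))).
rewrite (ffun_prod_factor p (fun j a => if j == k then f a else 1)).
rewrite -[RHS](prod_if_eq k (fun=> \sum_a p a * f a)); apply: eq_bigr => j _.
by case: eqP => // _; under eq_bigr do rewrite mulr1; rewrite (proj2 hp).
Qed.

Lemma iid_mean_cst r : Ex (fun=> r) = r.
Proof.
rewrite /iid_mean -mulr_suml -(bigA_distr_bigA (fun=> p)) /=.
by rewrite big1 ?mul1r // => k _; rewrite (proj2 hp).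
Qed.

Lemma iid_mean_coord2 k k' (f g : A -> R) : k != k' ->
  Ex (fun c => f (c k) * g (c k')) = (\sum_a p a * f a) * (\sum_a p a * g a).
Proof.
move=> kk'; rewrite /iid_mean.
under eq_bigr => c _ do rewrite -(prod_if_eq k (fun j => f (c j)))
  -(prod_if_eq k' (fun j => g (c j))) -big_split /=.
rewrite (ffun_prod_factor p
  (fun j a => (if j == k then f a else 1) * (if j == k' then g a else 1))).
rewrite -(prod_if_eq k (fun=> \sum_a p a * f a)).
rewrite -(prod_if_eq k' (fun=> \sum_a p a * g a)) -big_split /=.
apply: eq_bigr => j _; case: (eqVneq j k) => [->|_].
  rewrite (negbTE kk') mulr1; apply: eq_bigr => a _.
  by rewrite mulr1.
rewrite mul1r; case: eqP => _; first by under eq_bigr do rewrite mul1r.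
by under eq_bigr do rewrite !mulr1; rewrite (proj2 hp).
Qed.

Lemma iid_meanD F G : Ex (fun c => F c + G c) = Ex F + Ex G.
Proof. by rewrite /iid_mean -big_split; apply: eq_bigr => c _; rewrite mulrDr. Qed.

Lemma iid_meanZ r F : Ex (fun c => r * F c) = r * Ex F.
Proof. by rewrite /iid_mean big_distrr; apply: eq_bigr => c _ /=; rewrite mulrCA. Qed.

Lemma iid_mean_sum (I : finType) (P : pred I) (F : I -> {ffun K -> A} -> R) :
  Ex (fun c => \sum_(i | P i) F i c) = \sum_(i | P i) Ex (F i).
Proof.
rewrite /iid_mean exchange_big /=; apply: eq_bigr => c _.
by rewrite big_distrr.
Qed.

Lemma le_iid_mean F G : (forall c, F c <= G c) -> Ex F <= Ex G.
Proof.
move=> FG; apply: ler_sum => c _; apply: ler_wpM2l (FG c).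
by apply: prodr_ge0 => k _; apply: (proj1 hp).
Qed.

Lemma eq_iid_mean F G : (forall c, F c = G c) -> Ex F = Ex G.
Proof. by move=> FG; apply: eq_bigr => c _; rewrite FG. Qed.

(** Derandomization: if [F] stayed above [r] everywhere, its mean would exceed [r] strictly, because
    some family has positive weight. *)
Lemma exists_le_iid_mean F r : Ex F <= r -> exists c, F c <= r.
Proof.
move=> Fr; case: (boolP [exists c, F c <= r]) => [/existsP //|].
rewrite negb_exists => /forallP Fgt.
have p1 : \sum_(c : {ffun K -> A}) \prod_k p (c k) = 1.
  by rewrite -[RHS](iid_mean_cst 1); apply: eq_bigr => c _; rewrite mulr1.
have pge0 (c : {ffun K -> A}) : 0 <= \prod_k p (c k).
  by apply: prodr_ge0 => k _; apply: (proj1 hp).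
have [c pc] : exists c : {ffun K -> A}, 0 < \prod_k p (c k).
  apply/existsP; apply: contraT; rewrite negb_exists => /forallP p0.
  suff: (0 : R) = 1 by move/eqP; rewrite eq_sym oner_eq0.
  rewrite -p1 big1 // => c _.
  by apply/eqP; rewrite eq_le pge0 andbT leNgt.
have : 0 < Ex F - r.
  rewrite -{1}(iid_mean_cst r) /iid_mean -sumrB.
  rewrite (bigD1 c) //= ltr_pwDl //.
    by rewrite -mulrBr mulr_gt0 // subr_gt0 ltNge.
  apply: sumr_ge0 => d _; rewrite -mulrBr mulr_ge0 // subr_ge0 ltW //.
  by rewrite ltNge.
by rewrite subr_gt0 ltNge Fr.
Qed.

(** Independence and centering kill the cross terms. It serves twice: over random codewords for
    covering, and over source letters for Chebyshev's inequality. *)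
Lemma iid_mean_sqr_centered (g : A -> R) : \sum_a p a * g a = 0 ->
  Ex (fun c => (\sum_k g (c k)) ^+ 2) = #|K|%:R * \sum_a p a * g a ^+ 2.
Proof.
move=> g0.
rewrite (@eq_iid_mean _ (fun c => \sum_k \sum_k' g (c k) * g (c k'))); last first.
  by move=> c; rewrite expr2 mulr_suml; apply: eq_bigr => k _; rewrite mulr_sumr.
rewrite iid_mean_sum (eq_bigr (fun=> \sum_a p a * g a ^+ 2)).
  by rewrite sumr_const mulr_natl.
move=> k _; rewrite iid_mean_sum (bigD1 k) //= big1 ?addr0.
  exact: (iid_mean_coord k (fun a => g a * g a)).
by move=> k' k'k; rewrite iid_mean_coord2 1?eq_sym // g0 mul0r.
Qed.

End IidMean.

(* [E|avg w - 1|]: the part of [w] above the threshold [t] costs twice its mean; the rest has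
   variance at most [t / #|K|], and [|d| <= s/2 + d^2/(2s)] replaces Cauchy-Schwarz. *)
Lemma iid_mean_abs_dev {R : realType} {K A : finType} (p w : A -> R) (s t : R) :
  is_pmf p -> (forall a, 0 <= w a) -> \sum_a p a * w a = 1 ->
  (0 < #|K|)%N -> 0 < s -> 0 <= t ->
  iid_mean p (fun c : {ffun K -> A} => `| (\sum_k w (c k)) / #|K|%:R - 1 |) <=
  2 * (\sum_(a | t < w a) p a * w a) + (s / 2 + t / (2 * s * #|K|%:R)).
Proof.
move=> hp w0 w1 K0 s0 t0; set N : R := #|K|%:R.
have N0 : 0 < N by rewrite ltr0n.
pose w1' a := if t < w a then 0 else w a.
pose w2 a := if t < w a then w a else 0.
have wE a : w a = w1' a + w2 a by rewrite /w1' /w2; case: ifP; rewrite ?add0r ?addr0.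
pose m1 := \sum_a p a * w1' a; pose m2 := \sum_a p a * w2 a.
have m12 : m1 + m2 = 1.
  by rewrite -w1 -big_split; apply: eq_bigr => a _ /=; rewrite -mulrDr -wE.
have w20 a : 0 <= w2 a by rewrite /w2; case: ifP.
have w10 a : 0 <= w1' a by rewrite /w1'; case: ifP.
have m20 : 0 <= m2 by apply: sumr_ge0 => a _; rewrite mulr_ge0 // (proj1 hp).
have m10 : 0 <= m1 by apply: sumr_ge0 => a _; rewrite mulr_ge0 // (proj1 hp).
have m2E : \sum_(a | t < w a) p a * w a = m2.
  rewrite big_mkcond; apply: eq_bigr => a _; rewrite /w2.
  by case: ifP; rewrite ?mulr0.
pose g a := w1' a - m1.
have g0 : \sum_a p a * g a = 0.
  rewrite (eq_bigr (fun a => p a * w1' a - p a * m1)).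
    by rewrite sumrB -mulr_suml (proj2 hp) mul1r subrr.
  by move=> a _; rewrite mulrBr.
(* Truncation gives [w1' a ^+ 2 <= t * w1' a], and the mean [m1] is at most 1. *)
have vg : \sum_a p a * g a ^+ 2 <= t.
  apply: (@le_trans _ _ (\sum_a p a * (t * w1' a - 2 * m1 * w1' a + m1 ^+ 2))).
    apply: ler_sum => a _; apply: ler_wpM2l; first exact: (proj1 hp).
    rewrite /g sqrrB -mulr_natl.
    have : w1' a ^+ 2 <= t * w1' a.
      rewrite expr2; apply: ler_wpM2r => //.
      by rewrite /w1'; case: ltP.
    lra.
  rewrite (eq_bigr (fun a => t * (p a * w1' a) - (2 * m1) * (p a * w1' a)
                             + p a * m1 ^+ 2)); last by move=> a _; ring.
  rewrite big_split sumrB /= -!mulr_sumr -mulr_suml (proj2 hp) -/m1.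
  have : t * m1 <= t by rewrite ler_piMr //; lra.
  have := sqr_ge0 m1; rewrite expr2; lra.
apply: (@le_trans _ _ (iid_mean p (fun c : {ffun K -> A} =>
   (s / 2 + (2 * s * N ^+ 2)^-1 * (\sum_k g (c k)) ^+ 2)
   + ((\sum_k N^-1 * w2 (c k)) + m2)))).
  apply: le_iid_mean => // c.
  (* Since [m1 + m2 = 1], the deviation is a centred truncated average plus a tail average minus its
     mean [m2]. The latter is bounded by average plus mean, hence the factor 2 on the tail. *)
  have -> : (\sum_k w (c k)) / N - 1
     = (\sum_k g (c k)) / N + ((\sum_k N^-1 * w2 (c k)) - m2).
    rewrite -mulr_sumr sumrB (eq_bigr _ (fun k _ => wE (c k))) big_split /=.
    rewrite sumr_const -mulr_natl -[#|_|%:R]/N -m12; field.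
    by rewrite gt_eqF.
  apply: le_trans (ler_normD _ _) _; apply: lerD; last first.
    apply: le_trans (ler_normB _ _) _; rewrite !ger0_norm //.
    by apply: sumr_ge0 => k _; rewrite mulr_ge0 // invr_ge0 ltW.
  set G := \sum_k _.
  have -> : (2 * s * N ^+ 2)^-1 * G ^+ 2 = `|G / N| ^+ 2 / (2 * s).
    rewrite real_normK ?num_real //; field.
    by rewrite !gt_eqF.
  set d := `|_|.
  have : 0 <= (s - d) ^+ 2 / (2 * s) by rewrite divr_ge0 ?sqr_ge0 //; lra.
  have -> : (s - d) ^+ 2 / (2 * s) = s / 2 + d ^+ 2 / (2 * s) - d; last by lra.
  field; exact: lt0r_neq0.
rewrite !iid_meanD !iid_mean_cst // iid_meanZ iid_mean_sqr_centered //.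
have -> : iid_mean p (fun c : {ffun K -> A} => \sum_k N^-1 * w2 (c k)) = m2.
  rewrite iid_mean_sum (eq_bigr (fun=> N^-1 * m2)).
    by rewrite sumr_const -mulr_natl -[#|_|%:R]/N mulrA divff ?gt_eqF // mul1r.
  by move=> k _; rewrite iid_meanZ iid_mean_coord.
rewrite m2E.
have -> : (2 * s * N ^+ 2)^-1 * (N * (\sum_a p a * g a ^+ 2))
  = (\sum_a p a * g a ^+ 2) / (2 * s * N) by field; rewrite !gt_eqF.
have : (\sum_a p a * g a ^+ 2) / (2 * s * N) <= t / (2 * s * N).
  by rewrite ler_pM2r // invr_gt0 !mulr_gt0.
lra.
Qed.

(** * Random codes for one use of the source *)

Definition fst_marginal {R : realType} {A B : finType} (p : A -> B -> R) (a : A) : R :=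
  \sum_b p a b.

Definition snd_marginal {R : realType} {A B : finType} (p : A -> B -> R) (b : B) : R :=
  \sum_a p a b.

Lemma le_fst_marginal {R : realType} {A B : finType} (p : A -> B -> R) a b :
  (forall a b, 0 <= p a b) -> p a b <= fst_marginal p a.
Proof. by move=> p0; rewrite /fst_marginal (bigD1 b) //= lerDl sumr_ge0. Qed.

Lemma le_snd_marginal {R : realType} {A B : finType} (p : A -> B -> R) a b :
  (forall a b, 0 <= p a b) -> p a b <= snd_marginal p b.
Proof. by move=> p0; rewrite /snd_marginal (bigD1 a) //= lerDl sumr_ge0. Qed.

Definition joint_XU {R : realType} {X Z U : finType} (PXZ : X -> Z -> R)
  (PUX : X -> U -> R) (x : X) (u : U) : R := fst_marginal PXZ x * PUX x u.

Definition joint_UZ {R : realType} {X Z U : finType} (PXZ : X -> Z -> R)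
  (PUX : X -> U -> R) (u : U) (z : Z) : R := \sum_x PXZ x z * PUX x u.

(** With [block PXZ] as source this is [induced_joint] on tuples, so a bound for one use applies to
    blocks directly. *)
Definition coded_joint {R : realType} {X Y Z I : finType} (PXZ : X -> Z -> R)
  (E : X -> I -> R) (D : I * Z -> Y -> R) (x : X) (y : Y) (z : Z) : R :=
  PXZ x z * \sum_m E x m * D (m, z) y.

(** Triangle inequality through [Q], whose posterior is [V]: one distance is paid between [P] and
    [Q], and at most as much between their total masses spread by [V]. *)
Lemma l1_dist_channel {R : realType} {X : finType} (P Q V : X -> R) :
  is_pmf V -> (forall x, Q x = (\sum_x' Q x') * V x) ->
  \sum_x `| P x - (\sum_x' P x') * V x | <= 2 * \sum_x `| P x - Q x |.
Proof.
move=> hV QE.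
apply: (@le_trans _ _ (\sum_x (`|P x - Q x| + (\sum_x' `|P x' - Q x'|) * V x))).
  apply: ler_sum => x _.
  have -> : P x - (\sum_x' P x') * V x =
    (P x - Q x) - (\sum_x' (P x' - Q x')) * V x.
    rewrite sumrB mulrBl -QE; ring.
  apply: le_trans (ler_normB _ _) _; apply: lerD => //.
  rewrite normrM (ger0_norm (proj1 hV x)); apply: ler_wpM2r; first exact: (proj1 hV).
  exact: ler_norm_sum.
rewrite big_split /= -mulr_sumr (proj2 hV); lra.
Qed.

Section OneShot.
Context {R : realType} {X Y Z U : finType}.
Context (PXZ : X -> Z -> R) (PUX : X -> U -> R) (PYUZ : U * Z -> Y -> R).
Context (hPXZ : is_pmf (fun xz : X * Z => PXZ xz.1 xz.2)).
Context (hPUX : is_cpmf PUX) (hPYUZ : is_cpmf PYUZ).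

Local Notation PX := (fst_marginal PXZ).
Local Notation PZ := (snd_marginal PXZ).
Local Notation PXU := (joint_XU PXZ PUX).
Local Notation PUZ := (joint_UZ PXZ PUX).
Local Notation PU := (snd_marginal PXU).

Lemma PXZ_ge0 x z : 0 <= PXZ x z.
Proof. exact: (proj1 hPXZ (x, z)). Qed.

Lemma PUX_ge0 x u : 0 <= PUX x u.
Proof. exact: (proj1 (hPUX x) u). Qed.

Lemma PX_ge0 x : 0 <= PX x.
Proof. by apply: sumr_ge0 => z _; apply: PXZ_ge0. Qed.

Lemma PZ_ge0 z : 0 <= PZ z.
Proof. by apply: sumr_ge0 => x _; apply: PXZ_ge0. Qed.

Lemma joint_XU_ge0 x u : 0 <= PXU x u.
Proof. by rewrite mulr_ge0 ?PX_ge0 ?PUX_ge0. Qed.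

Lemma joint_UZ_ge0 u z : 0 <= PUZ u z.
Proof. by apply: sumr_ge0 => x _; rewrite mulr_ge0 ?PXZ_ge0 ?PUX_ge0. Qed.

Lemma sum_PX : \sum_x PX x = 1.
Proof. by rewrite -(proj2 hPXZ) pair_bigA. Qed.

Lemma sum_PZ : \sum_z PZ z = 1.
Proof. by rewrite -(proj2 hPXZ) exchange_big pair_bigA. Qed.

Lemma PU_ge0 u : 0 <= PU u.
Proof. by apply: sumr_ge0 => x _; apply: joint_XU_ge0. Qed.

Lemma fst_marginal_XU x : fst_marginal PXU x = PX x.
Proof. by rewrite /fst_marginal /joint_XU -mulr_sumr (proj2 (hPUX x)) mulr1. Qed.

Lemma pmf_XU : is_pmf (fun xu : X * U => PXU xu.1 xu.2).
Proof.
split=> [[x u]|]; first exact: joint_XU_ge0.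
rewrite -(pair_bigA _ PXU) -sum_PX /=.
by apply: eq_bigr => x _; apply: fst_marginal_XU.
Qed.

Lemma pmf_U : is_pmf PU.
Proof.
split; first exact: PU_ge0.
by rewrite -(proj2 pmf_XU) exchange_big pair_bigA.
Qed.

Lemma fst_marginal_UZ u : fst_marginal PUZ u = PU u.
Proof.
rewrite /fst_marginal /joint_UZ exchange_big; apply: eq_bigr => x _.
by rewrite -mulr_suml.
Qed.

Lemma snd_marginal_UZ z : snd_marginal PUZ z = PZ z.
Proof.
rewrite /snd_marginal /joint_UZ exchange_big; apply: eq_bigr => x _.
by rewrite -mulr_sumr (proj2 (hPUX x)) mulr1.
Qed.

Lemma pmf_UZ : is_pmf (fun uz : U * Z => PUZ uz.1 uz.2).
Proof.
split=> [[u z]|]; first exact: joint_UZ_ge0.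
rewrite -(pair_bigA _ PUZ) -(proj2 pmf_U) /=.
by apply: eq_bigr => u _; apply: fst_marginal_UZ.
Qed.

(* The density of [P_{X|U}] with respect to [P_X]; it is [0] where [PU u = 0]. *)
Definition lik (u : U) (x : X) : R := PUX x u / PU u.

(* [P_{Z|U}]; it is [0] where [PU u = 0]. *)
Definition cond_ZU (u : U) (z : Z) : R := PUZ u z / PU u.

Lemma lik_ge0 u x : 0 <= lik u x.
Proof. by rewrite divr_ge0 ?PUX_ge0 ?PU_ge0. Qed.

Lemma cond_ZU_ge0 u z : 0 <= cond_ZU u z.
Proof. by rewrite divr_ge0 ?joint_UZ_ge0 ?PU_ge0. Qed.

(** If [PU u = 0], the joint mass it dominates vanishes too, so the division by zero in [lik] does
    no harm. *)
Lemma lik_mul u x : PX x * (PU u * lik u x) = PXU x u.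
Proof.
rewrite /lik /joint_XU; have [u0|u0] := eqVneq (PU u) 0; last by field.
rewrite u0 mul0r mulr0; apply/esym/eqP; rewrite eq_le joint_XU_ge0 andbT.
by rewrite -u0; apply: le_snd_marginal joint_XU_ge0.
Qed.

Lemma cond_ZU_mul u z : PU u * cond_ZU u z = PUZ u z.
Proof.
rewrite /cond_ZU; have [u0|u0] := eqVneq (PU u) 0; last by field.
rewrite u0 mul0r; apply/esym/eqP; rewrite eq_le joint_UZ_ge0 andbT.
by rewrite -u0 -fst_marginal_UZ; apply: le_fst_marginal joint_UZ_ge0.
Qed.

Lemma cond_ZUE u z : cond_ZU u z = \sum_x PXZ x z * lik u x.
Proof.
by rewrite /cond_ZU /joint_UZ mulr_suml; apply: eq_bigr => x _; rewrite mulrA.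
Qed.

Lemma sum_cond_ZU z : \sum_u PU u * cond_ZU u z = PZ z.
Proof. by under eq_bigr do rewrite cond_ZU_mul; apply: snd_marginal_UZ. Qed.

(** At a null [x] the sum could fall below 1, since [PUX x] may charge letters with [PU u = 0],
    where [lik] is 0. *)
Lemma sum_lik x : PX x != 0 -> \sum_u PU u * lik u x = 1.
Proof.
move=> x0; apply: (mulfI x0); rewrite mulr_sumr mulr1 -[RHS]fst_marginal_XU.
by apply: eq_bigr => u _; rewrite lik_mul.
Qed.

(** * Likelihood encoder, threshold decoder and their mean errors *)

Section Code.
Context {M L : nat}.
Local Notation K := ('I_M.+1 * 'I_L.+1)%type.
Local Notation N := (#|{: K}|%:R : R).

Lemma card_code_gt0 : 0 < N.
Proof. by rewrite ltr0n card_prod !card_ord. Qed.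

Definition lik_sum (c : {ffun K -> U}) (x : X) : R := \sum_k lik (c k) x.

(** The factor [PX x] of the likelihood cancels in the normalization. The uniform default keeps this
    a PMF when every codeword has zero likelihood. *)
Definition lik_encoder (c : {ffun K -> U}) (x : X) (k : K) : R :=
  if lik_sum c x == 0 then N^-1 else lik (c k) x / lik_sum c x.

(** Soft covering: when all codewords have positive probability, this is the l1 distance from [PX]
    to the law of [X] generated by a uniformly chosen codeword. *)
Definition covering_error (c : {ffun K -> U}) : R :=
  \sum_x PX x * `| lik_sum c x / N - 1 |.

(** A likelihood ratio test written without a quotient, so that it makes sense where [PZ z = 0];
    [ord0] is an arbitrary answer when no index passes. *)
Definition threshold_decoder (t : R) (c : {ffun K -> U}) (m : 'I_M.+1) (z : Z) :
  'I_L.+1 := odflt ord0 [pick l | t * PZ z < cond_ZU (c (m, l)) z].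

Definition code_encoder (c : {ffun K -> U}) (x : X) (m : 'I_M.+1) : R :=
  \sum_l lik_encoder c x (m, l).

Definition code_decoder (t : R) (c : {ffun K -> U}) (mz : 'I_M.+1 * Z) : Y -> R :=
  PYUZ (c (mz.1, threshold_decoder t c mz.1 mz.2), mz.2).

Definition packing_error (t : R) (c : {ffun K -> U}) : R :=
  N^-1 * \sum_(k : K) \sum_z cond_ZU (c k) z * (threshold_decoder t c k.1 z != k.2)%:R.

Lemma lik_sum_ge0 c x : 0 <= lik_sum c x.
Proof. by apply: sumr_ge0 => k _; apply: lik_ge0. Qed.

Lemma lik_encoder_pmf c : is_cpmf (lik_encoder c).
Proof.
move=> x; rewrite /lik_encoder; split=> [k|].
  by case: ifP => _; rewrite ?invr_ge0 ?ler0n // divr_ge0 ?lik_ge0 ?lik_sum_ge0.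
have [S0|S0] := eqVneq (lik_sum c x) 0; last by rewrite -mulr_suml divff.
by rewrite sumr_const -[LHS]mulr_natl divff // gt_eqF // card_code_gt0.
Qed.

(** Both weights are proportional to [lik (c k) x], so all differences have one sign and the sum
    collapses. If all likelihoods vanish, both sides are 1. *)
Lemma lik_encoder_dist c x :
  \sum_k `| lik_encoder c x k - lik (c k) x / N | = `| lik_sum c x / N - 1 |.
Proof.
have N0 := card_code_gt0; rewrite /lik_encoder.
have [S0|S0] := eqVneq (lik_sum c x) 0.
  have w0 k : lik (c k) x = 0.
    move/eqP: S0; rewrite psumr_eq0 => [/allP/(_ k)|k' _]; last exact: lik_ge0.
    by rewrite mem_index_enum => /(_ isT)/eqP.
  rewrite S0 mul0r sub0r normrN1.
  rewrite (eq_bigr (fun=> N^-1)).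
    by rewrite sumr_const -[LHS]mulr_natl divff // gt_eqF.
  by move=> k _; rewrite w0 mul0r subr0 ger0_norm // invr_ge0 ltW.
have Sgt : 0 < lik_sum c x by rewrite lt0r S0 lik_sum_ge0.
rewrite (eq_bigr (fun k => lik (c k) x * `|(lik_sum c x)^-1 - N^-1|)).
  rewrite -mulr_suml -/(lik_sum c x) -[X in X * _]ger0_norm ?lik_sum_ge0 //.
  by rewrite -normrM mulrBr divff // distrC.
by move=> k _; rewrite -mulrBr normrM ger0_norm ?lik_ge0.
Qed.

(** This is [iid_mean_abs_dev] at each [x], averaged over [PX]; the event [t < lik u x] becomes an
    upper tail of the information density of [(X, U)]. *)
Lemma mean_covering_error (s t : R) : 0 < s -> 0 <= t ->
  iid_mean PU covering_error <=
  2 * (\sum_x \sum_(u | t * (PX x * PU u) < PXU x u) PXU x u)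
  + (s / 2 + t / (2 * s * N)).
Proof.
move=> s0 t0; rewrite /covering_error iid_mean_sum.
set C := s / 2 + _.
apply: (@le_trans _ _ (\sum_x
   (2 * (\sum_(u | t * (PX x * PU u) < PXU x u) PXU x u) + PX x * C))); last first.
  by rewrite big_split /= -mulr_sumr -mulr_suml sum_PX mul1r.
apply: ler_sum => x _; rewrite iid_meanZ.
(* Null letters carry no weight, and [sum_lik] does not cover them. *)
have [x0|x0] := eqVneq (PX x) 0.
  rewrite x0 !mul0r addr0 mulr_ge0 // sumr_ge0 // => u _; exact: joint_XU_ge0.
apply: le_trans (ler_wpM2l (PX_ge0 x) (@iid_mean_abs_dev _ K _ _
  (lik^~ x) s t pmf_U (lik_ge0^~ x) (sum_lik x x0) _ s0 t0)) _.
  by rewrite card_prod !card_ord.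
rewrite mulrDr lerD // mulrCA ler_pM2l // mulr_sumr.
rewrite big_mkcond [leRHS]big_mkcond; apply: ler_sum => u _; rewrite lik_mul.
case: ifP => [tw|_]; last by case: ifP => // _; apply: joint_XU_ge0.
have u0 : 0 < PU u.
  rewrite lt0r PU_ge0 andbT; apply: contraTneq tw => u0.
  by rewrite /lik u0 invr0 mulr0 -leNgt.
rewrite ifT //; move: tw; rewrite /lik ltr_pdivlMr // /joint_XU mulrCA => tw.
by rewrite ltr_pM2l // lt0r x0 PX_ge0.
Qed.

(** Union bound: a wrong answer means that the true codeword fails the test or one of the [L] others
    with the same [m] passes it. The latter are independent of [z], and a change of measure bounds
    the chance of each by [t^-1]. *)
Lemma mean_packing_error (t : R) : 0 < t ->
  iid_mean PU (packing_error t) <=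
  (\sum_u \sum_(z | PUZ u z <= t * (PU u * PZ z)) PUZ u z) + L%:R / t.
Proof.
move=> t0; have N0 := card_code_gt0; rewrite /packing_error iid_meanZ iid_mean_sum.
set C := (X in _ <= X).
rewrite mulrC ler_pdivrMr // mulr_natr -sumr_const; apply: ler_sum => -[m l] _ /=.
pose hit u z : R := (t * PZ z < cond_ZU u z)%R%:R.
apply: (@le_trans _ _ (iid_mean PU (fun c : {ffun K -> U} =>
    (\sum_z cond_ZU (c (m, l)) z * (1 - hit (c (m, l)) z))
    + \sum_(l' | l' != l) \sum_z cond_ZU (c (m, l)) z * hit (c (m, l')) z))).
  apply: le_iid_mean; first exact: pmf_U.
  move=> c; rewrite exchange_big -big_split /=; apply: ler_sum => z _.
  rewrite -mulr_sumr -mulrDr; apply: ler_wpM2l; first exact: cond_ZU_ge0.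
  have hit0 l' : 0 <= hit (c (m, l')) z by rewrite ler0n.
  have hit1 l' : 0 <= 1 - hit (c (m, l')) z by rewrite subr_ge0 /hit lern1 leq_b1.
  case: eqP => [_|/eqP dl]; first by rewrite addr_ge0 // sumr_ge0.
  move: dl; rewrite /threshold_decoder; case: pickP => [l' tl' /= l'l|no _].
    rewrite (bigD1 l') //= {2}/hit tl' addrCA lerDl addr_ge0 // sumr_ge0 //.
  rewrite /hit no subr0 lerDl sumr_ge0 //.
rewrite iid_meanD; apply: lerD.
  rewrite (iid_mean_coord _ _ (m, l)
    (fun u => \sum_z cond_ZU u z * (1 - hit u z))); last exact: pmf_U.
  apply: ler_sum => u _; rewrite mulr_sumr [leRHS]big_mkcond.
  apply: ler_sum => z _; rewrite mulrA cond_ZU_mul /hit.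
  case: ltP => h; rewrite ?subrr ?mulr0 ?subr0 ?mulr1.
    by case: ifP => // _; apply: joint_UZ_ge0.
  rewrite ifT // -cond_ZU_mul [leRHS]mulrCA ler_wpM2l //; exact: PU_ge0.
rewrite iid_mean_sum.
have <- : \sum_(l' : 'I_L.+1 | l' != l) t^-1 = L%:R / t.
  by rewrite sumr_const -[LHS]mulr_natl cardC1 card_ord.
apply: ler_sum => l' l'l; rewrite iid_mean_sum.
rewrite -[t^-1]mul1r -sum_PZ mulr_suml; apply: ler_sum => z _.
rewrite (iid_mean_coord2 _ _ _ _ (cond_ZU^~ z) (hit^~ z)); first last.
- by rewrite xpair_eqE eqxx eq_sym.
- exact: pmf_U.
(* A passed test gives [PZ z <= cond_ZU u z / t]; summing against [PU] leaves [PZ z / t]. *)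
rewrite sum_cond_ZU mulr_sumr -{2}sum_cond_ZU mulr_suml; apply: ler_sum => u _.
rewrite mulrCA -mulrA; apply: ler_wpM2l; first exact: PU_ge0.
rewrite ler_pdivlMr // /hit; case: ltP => [|_].
  by rewrite mulr1 mulrC => /ltW.
by rewrite mulr0 mul0r cond_ZU_ge0.
Qed.

(** The idealised law [Q] has posterior [W], so only the distance from [P] to [Q] matters. Replacing
    the encoder costs the covering error, replacing the decoder twice the packing error. *)
Lemma code_error (W : Y * Z -> X -> R) (t : R) (c : {ffun K -> U}) :
  is_cpmf W ->
  (forall u x y z, joint_UXYZ PXZ PUX PYUZ u x y z =
     (\sum_x' joint_UXYZ PXZ PUX PYUZ u x' y z) * W (y, z) x) ->
  let P := coded_joint PXZ (code_encoder c) (code_decoder t c) in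
  2^-1 * (\sum_x \sum_y \sum_z `| P x y z - (\sum_x' P x' y z) * W (y, z) x |) <=
  covering_error c + 2 * packing_error t c.
Proof.
move=> hW hJ /=; set P := coded_joint _ _ _.
pose Q x y z := \sum_k PXZ x z * (lik (c k) x / N) * PYUZ (c k, z) y.
have N0 := card_code_gt0.
(* For a fixed codeword the summand is [joint_UXYZ] times a factor free of [x], so the posterior
   identity passes to the mixture over [k]. *)
have QE x y z : Q x y z = (\sum_x' Q x' y z) * W (y, z) x.
  rewrite /Q exchange_big mulr_suml; apply: eq_bigr => k _ /=.
  have E x' : PXZ x' z * (lik (c k) x' / N) * PYUZ (c k, z) y =
    joint_UXYZ PXZ PUX PYUZ (c k) x' y z * ((PU (c k))^-1 / N).
    by rewrite /lik /joint_UXYZ; ring.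
  rewrite E hJ mulrAC; congr (_ * _); rewrite mulr_suml.
  by apply: eq_bigr => x' _; rewrite E.
have swap F : \sum_x \sum_y \sum_z F x y z = \sum_y \sum_z \sum_(x : X) F x y z :> R.
  by rewrite exchange_big; apply: eq_bigr => y _; rewrite exchange_big.
have PQ : \sum_x \sum_y \sum_z `|P x y z - (\sum_x' P x' y z) * W (y, z) x|
    <= 2 * \sum_x \sum_y \sum_z `|P x y z - Q x y z|.
  rewrite !swap mulr_sumr; apply: ler_sum => y _.
  rewrite mulr_sumr; apply: ler_sum => z _.
  apply: (l1_dist_channel (fun x => P x y z) (fun x => Q x y z) (W (y, z))) => [|x].
    exact: hW.
  exact: QE.
(* The factor 2 in [PQ] cancels the half in the total variation. *)
suff : \sum_x \sum_y \sum_z `|P x y z - Q x y z| <=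
    covering_error c + 2 * packing_error t c.
  move: PQ; set a := \sum_x _; set b := \sum_x _; lra.
pose err (k : K) z : R := (threshold_decoder t c k.1 z != k.2)%:R.
pose D m z y := PYUZ (c (m, threshold_decoder t c m z), z) y.
have D0 m z y : 0 <= D m z y by apply: (proj1 (hPYUZ _)).
have Derr (k : K) z : \sum_y `|D k.1 z y - PYUZ (c k, z) y| <= 2 * err k z.
  rewrite /err /D; case: eqP => [->|_] /=.
    by rewrite mulr0 big1 // => y _; rewrite -surjective_pairing subrr normr0.
  apply: (@le_trans _ _ (\sum_y (D k.1 z y + PYUZ (c k, z) y))).
    apply: ler_sum => y _; apply: le_trans (ler_normB _ _) _.
    by rewrite !ger0_norm // (proj1 (hPYUZ _)).
  rewrite big_split /= (proj2 (hPYUZ _)) (proj2 (hPYUZ _)); lra.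
apply: (@le_trans _ _ (\sum_x \sum_z \sum_k PXZ x z *
   (`|lik_encoder c x k - lik (c k) x / N| + lik (c k) x / N * (2 * err k z)))).
  apply: ler_sum => x _; rewrite exchange_big; apply: ler_sum => z _ /=.
  apply: (@le_trans _ _ (\sum_y \sum_k PXZ x z *
     (`|lik_encoder c x k - lik (c k) x / N| * D k.1 z y +
      lik (c k) x / N * `|D k.1 z y - PYUZ (c k, z) y|))).
    apply: ler_sum => y _.
    have -> : P x y z = \sum_(k : K) PXZ x z * (lik_encoder c x k * D k.1 z y).
      rewrite /P /coded_joint /code_encoder -mulr_sumr; congr (_ * _).
      under eq_bigr do rewrite mulr_suml.
      by rewrite pair_bigA; apply: eq_bigr => -[].
    rewrite /Q -sumrB; apply: le_trans (ler_norm_sum _ _ _) _.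
    apply: ler_sum => k _.
    (* The encoder is changed while the actual decoder is kept; the decoder is then changed under
       the ideal weights, as [packing_error] requires. *)
    have -> : PXZ x z * (lik_encoder c x k * D k.1 z y) -
      PXZ x z * (lik (c k) x / N) * PYUZ (c k, z) y =
      PXZ x z * ((lik_encoder c x k - lik (c k) x / N) * D k.1 z y +
      lik (c k) x / N * (D k.1 z y - PYUZ (c k, z) y)) by ring.
    rewrite normrM ger0_norm ?PXZ_ge0 // ler_wpM2l ?PXZ_ge0 //.
    have wN : 0 <= lik (c k) x / N by rewrite divr_ge0 ?lik_ge0 // ltW.
    apply: le_trans (ler_normD _ _) _; rewrite normrM (ger0_norm (D0 _ _ _)) lerD2l.
    by rewrite normrM (ger0_norm wN).
  rewrite exchange_big; apply: ler_sum => k _ /=; rewrite -mulr_sumr.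
  rewrite ler_wpM2l ?PXZ_ge0 // big_split /= -!mulr_sumr (proj2 (hPYUZ _)) mulr1.
  by rewrite lerD2l ler_wpM2l // divr_ge0 ?lik_ge0 // ltW.
rewrite le_eqVlt; apply/orP; left; apply/eqP.
(* Summing out [z] turns the encoder part into [covering_error]; summing out [x] turns the weights
   of the decoder part into [cond_ZU]. *)
transitivity (\sum_x \sum_z (PXZ x z * `|lik_sum c x / N - 1| +
   \sum_k 2 * N^-1 * (PXZ x z * lik (c k) x * err k z))).
  apply: eq_bigr => x _; apply: eq_bigr => z _; rewrite -lik_encoder_dist.
  rewrite mulr_sumr -big_split; apply: eq_bigr => k _ /=; ring.
under eq_bigr do rewrite big_split /= -mulr_suml.
rewrite big_split /=; congr (_ + _).
rewrite /packing_error mulrA mulr_sumr.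
under eq_bigr do rewrite exchange_big /=.
rewrite exchange_big; apply: eq_bigr => k _ /=.
rewrite exchange_big mulr_sumr; apply: eq_bigr => z _ /=.
by rewrite -mulr_sumr -mulr_suml -cond_ZUE.
Qed.

End Code.

(** A single code must be good for both errors at once, so it is selected through the mean of their
    weighted sum. Here [t] is the covering threshold, [t'] the decoding threshold and [s] the free
    parameter of the second-moment bound. *)
Lemma one_shot (W : Y * Z -> X -> R) (M L : nat) (s t t' : R) :
  is_cpmf W ->
  (forall u x y z, joint_UXYZ PXZ PUX PYUZ u x y z =
     (\sum_x' joint_UXYZ PXZ PUX PYUZ u x' y z) * W (y, z) x) ->
  0 < s -> 0 <= t -> 0 < t' ->
  exists (E : X -> 'I_M.+1 -> R) (D : 'I_M.+1 * Z -> Y -> R),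
  let P := coded_joint PXZ E D in
  [/\ is_cpmf E, is_cpmf D &
  2^-1 * (\sum_x \sum_y \sum_z `| P x y z - (\sum_x' P x' y z) * W (y, z) x |) <=
  2 * (\sum_x \sum_(u | t * (PX x * PU u) < PXU x u) PXU x u)
  + (s / 2 + t / (2 * s * (M.+1%:R * L.+1%:R)))
  + 2 * ((\sum_u \sum_(z | PUZ u z <= t' * (PU u * PZ z)) PUZ u z) + L%:R / t')].
Proof.
move=> hW hJ s0 t0 t'0.
have [c cb] := exists_le_iid_mean _ pmf_U (fun c : {ffun 'I_M.+1 * 'I_L.+1 -> U} =>
  covering_error c + 2 * packing_error t' c) _ (lexx _).
exists (code_encoder c), (code_decoder t' c) => /=.
split=> [x|mz|]; first split=> [m|].
- by apply: sumr_ge0 => l _; apply: (proj1 (lik_encoder_pmf c x)).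
- by rewrite pair_bigA -(proj2 (lik_encoder_pmf c x)); apply: eq_bigr => -[].
- exact: hPYUZ.
apply: le_trans (code_error W t' c hW hJ) (le_trans cb _).
rewrite iid_meanD iid_meanZ; apply: lerD.
  by have := @mean_covering_error M L s t s0 t0; rewrite card_prod !card_ord natrM.
by rewrite ler_pM2l //; apply: mean_packing_error.
Qed.

End OneShot.

(** * Blocks and typicality *)

Definition info_density {R : realType} {A B : finType} (p : A -> B -> R) (a : A) (b : B) : R :=
  ln (p a b / (fst_marginal p a * snd_marginal p b)).

Definition info_variance {R : realType} {A B : finType} (p : A -> B -> R) : R :=
  \sum_a \sum_b p a b * (info_density p a b - mutual_info p) ^+ 2.

Definition block {R : realType} {A B : finType} {n : nat} (p : A -> B -> R)
  (s : n.-tuple A) (t : n.-tuple B) : R := \prod_(i < n) p (tnth s i) (tnth t i).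

Definition block_kernel {R : realType} {A B C : finType} {n : nat} (p : A * B -> C -> R)
  (st : n.-tuple A * n.-tuple B) (r : n.-tuple C) : R :=
  \prod_(i < n) p (tnth st.1 i, tnth st.2 i) (tnth r i).

Lemma sum_tuple_prod {R : realType} {A : finType} {n : nat} (F : 'I_n -> A -> R) :
  \sum_(t : n.-tuple A) \prod_(i < n) F i (tnth t i) = \prod_(i < n) \sum_a F i a.
Proof.
rewrite bigA_distr_bigA /= (reindex (fun f : {ffun 'I_n -> A} => [tuple f i | i < n])) /=.
  by apply: eq_bigr => f _; apply: eq_bigr => i _; rewrite tnth_mktuple.
exists (fun t => [ffun i => tnth t i]) => [f _|t _].
  by apply/ffunP => i; rewrite ffunE tnth_mktuple.
by apply: eq_from_tnth => i; rewrite tnth_mktuple ffunE.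
Qed.

(** Turns two tuples into one family of pairs, so that [iid_mean] applies to source blocks. *)
Lemma sum_tuple_pair {R : realType} {A B : finType} {n : nat}
  (F : n.-tuple A -> n.-tuple B -> R) :
  \sum_s \sum_t F s t =
  \sum_(f : {ffun 'I_n -> A * B}) F [tuple (f i).1 | i < n] [tuple (f i).2 | i < n].
Proof.
rewrite pair_bigA (reindex (fun f : {ffun 'I_n -> A * B} =>
  ([tuple (f i).1 | i < n], [tuple (f i).2 | i < n]))) //=.
exists (fun st => [ffun i => (tnth st.1 i, tnth st.2 i)]) => [f _|[s t] _].
  by apply/ffunP => i; rewrite ffunE !tnth_mktuple -surjective_pairing.
by congr pair; apply: eq_from_tnth => i; rewrite tnth_mktuple ffunE.
Qed.

Section Block.
Context {R : realType} {A B : finType} (p : A -> B -> R) {n : nat}.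

Lemma fst_marginal_block (s : n.-tuple A) :
  fst_marginal (block p) s = \prod_(i < n) fst_marginal p (tnth s i).
Proof. exact: (sum_tuple_prod (fun i b => p (tnth s i) b)). Qed.

Lemma snd_marginal_block (t : n.-tuple B) :
  snd_marginal (block p) t = \prod_(i < n) snd_marginal p (tnth t i).
Proof. exact: (sum_tuple_prod (fun i a => p a (tnth t i))). Qed.

Lemma block_cpmf : is_cpmf p -> is_cpmf (@block R A B n p).
Proof.
move=> hp s; split=> [t|]; first by apply: prodr_ge0 => i _; apply: (proj1 (hp _)).
by rewrite [LHS]fst_marginal_block big1 // => i _; apply: (proj2 (hp _)).
Qed.

Lemma block_pmf : is_pmf (fun ab : A * B => p ab.1 ab.2) ->
  is_pmf (fun st : n.-tuple A * n.-tuple B => block p st.1 st.2).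
Proof.
move=> hp; split=> [[s t]|].
  by apply: prodr_ge0 => i _; apply: (proj1 hp (_, _)).
rewrite -(pair_bigA _ (fun s t => block p s t)) /=.
rewrite (eq_bigr _ (fun s _ => fst_marginal_block s)).
rewrite (sum_tuple_prod (fun=> fst_marginal p)) big1 // => i _.
by rewrite /fst_marginal pair_bigA (proj2 hp).
Qed.

End Block.

Lemma block_kernel_cpmf {R : realType} {A B C : finType} {n : nat} (p : A * B -> C -> R) :
  is_cpmf p -> is_cpmf (@block_kernel R A B C n p).
Proof.
move=> hp st; split=> [t|]; first by apply: prodr_ge0 => i _; apply: (proj1 (hp _)).
rewrite [LHS](sum_tuple_prod (fun i => p (tnth st.1 i, tnth st.2 i))).
by rewrite big1 // => i _; apply: (proj2 (hp _)).
Qed.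

(** * Concentration of the information density over blocks *)

Section Typicality.
Context {R : realType} {A B : finType} (p : A -> B -> R).
Context (hp : is_pmf (fun ab : A * B => p ab.1 ab.2)).
Local Notation I := (mutual_info p).

Let p_ge0 a b : 0 <= p a b.
Proof. exact: (proj1 hp (a, b)). Qed.

Lemma mutual_infoE : I = \sum_a \sum_b p a b * info_density p a b.
Proof.
apply: eq_bigr => a _; apply: eq_bigr => b _; case: ifP => // /negbT.
by rewrite -leNgt => p0; rewrite (_ : p a b = 0) ?mul0r //; apply/eqP; rewrite eq_le p0 p_ge0.
Qed.

Lemma info_variance_ge0 : 0 <= info_variance p.
Proof.
by apply: sumr_ge0 => a _; apply: sumr_ge0 => b _; rewrite mulr_ge0 ?sqr_ge0.
Qed.

Lemma info_densityE a b : 0 < p a b ->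
  p a b = expR (info_density p a b) * (fst_marginal p a * snd_marginal p b).
Proof.
move=> ab0; have a0 := lt_le_trans ab0 (le_fst_marginal _ a b p_ge0).
have b0 := lt_le_trans ab0 (le_snd_marginal _ a b p_ge0).
by rewrite lnK ?posrE ?divr_gt0 ?mulr_gt0 // divfK // gt_eqF // mulr_gt0.
Qed.

Lemma block_gt0 n (s : n.-tuple A) (t : n.-tuple B) : 0 < block p s t ->
  forall i, 0 < p (tnth s i) (tnth t i).
Proof.
move=> st0 i; rewrite lt0r p_ge0 andbT; apply: contraTneq st0 => pi0.
by rewrite /block (bigD1 i) //= pi0 mul0r ltxx.
Qed.

Lemma block_info_density n (s : n.-tuple A) (t : n.-tuple B) : 0 < block p s t ->
  block p s t = expR (\sum_(i < n) info_density p (tnth s i) (tnth t i)) *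
    (fst_marginal (block p) s * snd_marginal (block p) t).
Proof.
move=> st0; rewrite fst_marginal_block snd_marginal_block expR_sum -!big_split /=.
by apply: eq_bigr => i _; apply: info_densityE; apply: block_gt0.
Qed.

(** The sum of centred densities has second moment [n] times [info_variance]. The condition on [bad]
    is asked only at positive mass, where the logarithms are meaningful. *)
Lemma block_chebyshev n (d : R) (bad : n.-tuple A -> n.-tuple B -> bool) :
  (0 < n)%N -> 0 < d ->
  (forall s t, 0 < block p s t -> bad s t ->
     (n%:R * d) ^+ 2 <= (\sum_(i < n) (info_density p (tnth s i) (tnth t i) - I)) ^+ 2) ->
  \sum_s \sum_(t | bad s t) block p s t <= info_variance p / (n%:R * d ^+ 2).
Proof.
move=> n0 d0 badP; have nR : 0 < n%:R :> R by rewrite ltr0n.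
pose g (ab : A * B) := info_density p ab.1 ab.2 - I.
have g0 : \sum_ab p ab.1 ab.2 * g ab = 0.
  rewrite (eq_bigr (fun ab => p ab.1 ab.2 * info_density p ab.1 ab.2 - p ab.1 ab.2 * I)).
    rewrite sumrB -mulr_suml (proj2 hp) mul1r mutual_infoE.
    by rewrite (pair_bigA _ (fun a b => p a b * info_density p a b)) subrr.
  by move=> ab _; rewrite mulrBr.
have := @iid_mean_sqr_centered R 'I_n _ _ hp g g0.
rewrite card_ord -(pair_bigA _ (fun a b => p a b * g (a, b) ^+ 2)) -/(info_variance p).
have -> : iid_mean (fun ab => p ab.1 ab.2)
    (fun c : {ffun 'I_n -> A * B} => (\sum_k g (c k)) ^+ 2) =
  \sum_s \sum_t block p s t *
    (\sum_(i < n) (info_density p (tnth s i) (tnth t i) - I)) ^+ 2.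
  rewrite sum_tuple_pair; apply: eq_bigr => c _; rewrite /block.
  by congr (_ * _ ^+ 2); apply: eq_bigr => i _; rewrite !tnth_mktuple.
move=> E.
have -> : info_variance p / (n%:R * d ^+ 2) =
    (n%:R * info_variance p) / (n%:R * d) ^+ 2 by field; rewrite !gt_eqF.
rewrite -E ler_pdivlMr ?exprn_gt0 ?mulr_gt0 // mulr_suml; apply: ler_sum => s _.
rewrite mulr_suml big_mkcond; apply: ler_sum => t _.
have b0 : 0 <= block p s t by apply: prodr_ge0 => i _.
case: ifP => [st|_]; last by rewrite mulr_ge0 ?sqr_ge0.
have [->|bn0] := eqVneq (block p s t) 0; first by rewrite !mul0r.
by apply: ler_wpM2l => //; apply: badP => //; rewrite lt0r bn0.
Qed.

Lemma block_marginals_gt0 n (s : n.-tuple A) (t : n.-tuple B) : 0 < block p s t ->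
  0 < fst_marginal (block p) s * snd_marginal (block p) t.
Proof.
by move=> st0; move: (st0); rewrite (block_info_density _ _ _ st0) pmulr_rgt0 ?expR_gt0.
Qed.

Lemma block_upper_tail n (d : R) : (0 < n)%N -> 0 < d ->
  \sum_(s : n.-tuple A) \sum_(t | expR (n%:R * (I + d)) *
     (fst_marginal (block p) s * snd_marginal (block p) t) < block p s t) block p s t
  <= info_variance p / (n%:R * d ^+ 2).
Proof.
move=> n0 d0; apply: block_chebyshev => // s t st0.
rewrite [X in _ < X]block_info_density // ltr_pM2r ?block_marginals_gt0 // ltr_expR.
rewrite sumrB sumr_const card_ord -[I *+ n]mulr_natl => h.
rewrite ler_sqr ?nnegrE ?mulr_ge0 ?ler0n ?(ltW d0) //; first lra.
by have := mulr_ge0 (ler0n R n) (ltW d0); lra.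
Qed.

Lemma block_lower_tail n (d : R) : (0 < n)%N -> 0 < d ->
  \sum_(s : n.-tuple A) \sum_(t | block p s t <= expR (n%:R * (I - d)) *
     (fst_marginal (block p) s * snd_marginal (block p) t)) block p s t
  <= info_variance p / (n%:R * d ^+ 2).
Proof.
move=> n0 d0; apply: block_chebyshev => // s t st0.
rewrite [X in X <= _]block_info_density // ler_pM2r ?block_marginals_gt0 // ler_expR.
rewrite sumrB sumr_const card_ord -[I *+ n]mulr_natl => h.
(* The centred sum is at most [- (n%:R * d)], so it is negated before squares are compared. *)
rewrite -[leRHS]sqrrN.
rewrite ler_sqr ?nnegrE ?mulr_ge0 ?ler0n ?(ltW d0) //; first lra.
by have := mulr_ge0 (ler0n R n) (ltW d0); lra.
Qed.

End Typicality.

(** * Joint laws of blocks and data processing *)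

Section Joints.
Context {R : realType} {X Z U : finType} (PXZ : X -> Z -> R) (PUX : X -> U -> R).

Lemma joint_XU_block n :
  joint_XU (@block _ _ _ n PXZ) (block PUX) = block (joint_XU PXZ PUX).
Proof.
apply/funext => s; apply/funext => t.
by rewrite /joint_XU fst_marginal_block -big_split.
Qed.

Lemma joint_UZ_block n :
  joint_UZ (@block _ _ _ n PXZ) (block PUX) = block (joint_UZ PXZ PUX).
Proof.
apply/funext => s; apply/funext => t; rewrite /joint_UZ.
rewrite -[RHS](sum_tuple_prod (fun i x => PXZ x (tnth t i) * PUX x (tnth s i))).
by apply: eq_bigr => xs _; rewrite -big_split.
Qed.

Context (hPXZ : is_pmf (fun xz : X * Z => PXZ xz.1 xz.2)) (hPUX : is_cpmf PUX).

(** Follows from [ln q <= q - 1], with [q] the ratio of [P_{U|Z}(u|z)] to [P_{U|X}(u|x)]. It makes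
    the exponent of the number of messages nonnegative. *)
Lemma data_processing :
  mutual_info (joint_UZ PXZ PUX) <= mutual_info (joint_XU PXZ PUX).
Proof.
have hXU := pmf_XU PXZ PUX hPXZ hPUX; have hUZ := pmf_UZ PXZ PUX hPXZ hPUX.
have XZ0 := PXZ_ge0 PXZ hPXZ; have UX0 := PUX_ge0 PUX hPUX.
have UZ0 := joint_UZ_ge0 PXZ PUX hPXZ hPUX.
have Z0 := PZ_ge0 PXZ hPXZ.
set fUZ := info_density (joint_UZ PXZ PUX); set fXU := info_density (joint_XU PXZ PUX).
have EUZ : mutual_info (joint_UZ PXZ PUX) =
    \sum_u \sum_z \sum_x PXZ x z * PUX x u * fUZ u z.
  rewrite mutual_infoE //; apply: eq_bigr => u _; apply: eq_bigr => z _.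
  by rewrite -mulr_suml.
have EXU : mutual_info (joint_XU PXZ PUX) =
    \sum_u \sum_z \sum_x PXZ x z * PUX x u * fXU x u.
  rewrite mutual_infoE // exchange_big; apply: eq_bigr => u _.
  rewrite exchange_big; apply: eq_bigr => x _.
  by rewrite -!mulr_suml.
rewrite -subr_le0 EUZ EXU -sumrB.
(* The bound compares the masses of [P_{XZ} P_{U|Z}] and [P_{XZ} P_{U|X}]; it is nonpositive once
   [x] is summed out. *)
apply: (@le_trans _ _ (\sum_u \sum_z \sum_x
   (PXZ x z * (joint_UZ PXZ PUX u z / snd_marginal PXZ z) - PXZ x z * PUX x u))).
  apply: ler_sum => u _; rewrite -sumrB; apply: ler_sum => z _.
  rewrite -sumrB; apply: ler_sum => x _; rewrite -mulrBr.
  have [r0|r0] := eqVneq (PXZ x z * PUX x u) 0.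
    by rewrite r0 mul0r subr0 mulr_ge0 // divr_ge0.
  have xz : 0 < PXZ x z.
    by rewrite lt0r XZ0 andbT; apply: contraNneq r0 => ->; rewrite mul0r.
  have xu : 0 < PUX x u.
    by rewrite lt0r UX0 andbT; apply: contraNneq r0 => ->; rewrite mulr0.
  have x0 := lt_le_trans xz (le_fst_marginal _ x z XZ0).
  have z0 := lt_le_trans xz (le_snd_marginal _ x z XZ0).
  have xu' : 0 < joint_XU PXZ PUX x u by rewrite mulr_gt0.
  have u0 := lt_le_trans xu' (le_snd_marginal _ x u (joint_XU_ge0 PXZ PUX hPXZ hPUX)).
  have uz : 0 < joint_UZ PXZ PUX u z.
    rewrite /joint_UZ (bigD1 x) //= ltr_pwDl ?mulr_gt0 // sumr_ge0 // => x' _.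
    by rewrite mulr_ge0.
  rewrite /fUZ /fXU /info_density fst_marginal_UZ // snd_marginal_UZ //.
  rewrite fst_marginal_XU // -ln_div ?posrE ?divr_gt0 ?mulr_gt0 //.
  set q := (X in ln X).
  have qE : q = joint_UZ PXZ PUX u z / (snd_marginal PXZ z * PUX x u).
    by rewrite /q /joint_XU; field; rewrite !gt_eqF.
  have q0 : 0 < q by rewrite qE divr_gt0 // mulr_gt0.
  have -> : PXZ x z * (joint_UZ PXZ PUX u z / snd_marginal PXZ z) - PXZ x z * PUX x u
     = PXZ x z * PUX x u * (q - 1) by rewrite qE; field; rewrite !gt_eqF.
  rewrite ler_pM2l ?mulr_gt0 //.
  have := @le_ln1Dx R (q - 1); rewrite [1 + _]addrC subrK; apply; lra.
apply: sumr_le0 => u _; apply: sumr_le0 => z _.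
rewrite sumrB -mulr_suml -/(snd_marginal PXZ z) -/(joint_UZ PXZ PUX u z) subr_le0.
have [->|zn0] := eqVneq (snd_marginal PXZ z) 0; first by rewrite mul0r.
by rewrite mulrCA divff // mulr1.
Qed.

End Joints.

(** * Achievability *)

(** The chain [X - (Y, Z) - U] says that [U] adds nothing to the posterior of [X], which is [W].
    Where [(y, z)] has no mass, both sides vanish. *)
Lemma joint_posterior {R : realType} {X Y Z U : finType}
  (PXZ : X -> Z -> R) (W : Y * Z -> X -> R) (PUX : X -> U -> R) (PYUZ : U * Z -> Y -> R) :
  (forall u x y z, 0 <= joint_UXYZ PXZ PUX PYUZ u x y z) ->
  (forall x y z,
     0 < \sum_x' \sum_u joint_UXYZ PXZ PUX PYUZ u x' y z ->
     (\sum_u joint_UXYZ PXZ PUX PYUZ u x y z) /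
       (\sum_x' \sum_u joint_UXYZ PXZ PUX PYUZ u x' y z) = W (y, z) x) ->
  markov_chain (fun (x : X) (yz : Y * Z) (u : U) =>
            joint_UXYZ PXZ PUX PYUZ u x yz.1 yz.2) ->
  forall u x y z, joint_UXYZ PXZ PUX PYUZ u x y z =
     (\sum_x' joint_UXYZ PXZ PUX PYUZ u x' y z) * W (y, z) x.
Proof.
move=> J0 hcond hM u x y z.
set J := joint_UXYZ PXZ PUX PYUZ in J0 hcond hM *.
have [yz|yz] := ltP 0 (\sum_x' \sum_u' J u' x' y z).
  have := hM x (y, z) u yz; rewrite /= hcond //.
  set S := (X in _ / X = _); set T := (X in _ * (X / _)).
  move=> /(congr1 ( *%R^~ S)); rewrite divfK ?gt_eqF // => ->.
  by rewrite -mulrA divfK ?gt_eqF // mulrC.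
have J00 x' u' : J u' x' y z = 0.
  apply/eqP; rewrite eq_le J0 andbT; apply: le_trans yz.
  rewrite (bigD1 x') //= (bigD1 u') //= -addrA lerDl addr_ge0 //.
    by apply: sumr_ge0.
  by apply: sumr_ge0 => ? _; apply: sumr_ge0.
by rewrite J00 big1 ?mul0r.
Qed.

Lemma joint_posterior_block {R : realType} {X Y Z U : finType} {n : nat}
  (PXZ : X -> Z -> R) (W : Y * Z -> X -> R) (PUX : X -> U -> R) (PYUZ : U * Z -> Y -> R) :
  (forall u x y z, joint_UXYZ PXZ PUX PYUZ u x y z =
     (\sum_x' joint_UXYZ PXZ PUX PYUZ u x' y z) * W (y, z) x) ->
  forall (u : n.-tuple U) x y z,
  joint_UXYZ (block PXZ) (block PUX) (block_kernel PYUZ) u x y z =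
  (\sum_x' joint_UXYZ (block PXZ) (block PUX) (block_kernel PYUZ) u x' y z) *
     block_kernel W (y, z) x.
Proof.
move=> hJ u x y z.
have JE x' : joint_UXYZ (block PXZ) (block PUX) (block_kernel PYUZ) u x' y z =
    \prod_(i < n) joint_UXYZ PXZ PUX PYUZ (tnth u i) (tnth x' i) (tnth y i) (tnth z i).
  by rewrite /joint_UXYZ !big_split.
rewrite (eq_bigr _ (fun x' _ => JE x')) JE.
rewrite (sum_tuple_prod (fun i x' => joint_UXYZ PXZ PUX PYUZ (tnth u i) x' (tnth y i) (tnth z i))).
by rewrite -big_split; apply: eq_bigr => i _; apply: hJ.
Qed.

(** This crude decay suffices, since the Chebyshev tails are of order [1 / n] anyway. *)
Lemma expRN_le_inv {R : realType} (x : R) : 0 < x -> expR (- x) <= x^-1.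
Proof.
move=> x0; rewrite expRN lef_pV2 ?posrE ?expR_gt0 //.
by apply: le_trans (expR_ge1Dx x); rewrite lerDr.
Qed.

Theorem theorem2 (R : realType) (X Y Z : finType)
  (PXZ : X -> Z -> R) (W : Y * Z -> X -> R) (Rt : R)
  (hPXZ : is_pmf (fun xz : X * Z => PXZ xz.1 xz.2))
  (hW : is_cpmf W)
  (U : finType) (PUX : X -> U -> R) (PYUZ : U * Z -> Y -> R)
  (hPUX : is_cpmf PUX) (hPYUZ : is_cpmf PYUZ)
  (hcond : forall x y z,
     0 < \sum_x' \sum_u joint_UXYZ PXZ PUX PYUZ u x' y z ->
     (\sum_u joint_UXYZ PXZ PUX PYUZ u x y z) /
       (\sum_x' \sum_u joint_UXYZ PXZ PUX PYUZ u x' y z) = W (y, z) x)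
  (hZXU : markov_chain (fun (z : Z) (x : X) (u : U) =>
            \sum_y joint_UXYZ PXZ PUX PYUZ u x y z))
  (hXUZY : markov_chain (fun (x : X) (uz : U * Z) (y : Y) =>
            joint_UXYZ PXZ PUX PYUZ uz.1 x y uz.2))
  (hXYZU : markov_chain (fun (x : X) (yz : Y * Z) (u : U) =>
            joint_UXYZ PXZ PUX PYUZ u x yz.1 yz.2))
  (hR : mutual_info (fun (x : X) (u : U) =>
            \sum_y \sum_z joint_UXYZ PXZ PUX PYUZ u x y z)
        - mutual_info (fun (u : U) (z : Z) =>
            \sum_x \sum_y joint_UXYZ PXZ PUX PYUZ u x y z) <= Rt) :
  achievable_rate PXZ W Rt.
Proof.
have J0 u x y z : 0 <= joint_UXYZ PXZ PUX PYUZ u x y z.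
  apply: mulr_ge0; last exact: (proj1 (hPYUZ _)).
  by apply: mulr_ge0; [apply: PXZ_ge0|apply: PUX_ge0].
have hJ := joint_posterior PXZ W PUX PYUZ J0 hcond hXYZU.
have EXU : (fun x u => \sum_y \sum_z joint_UXYZ PXZ PUX PYUZ u x y z) = joint_XU PXZ PUX.
  apply/funext => x; apply/funext => u; rewrite exchange_big /joint_XU mulr_suml.
  by apply: eq_bigr => z _; rewrite -mulr_sumr (proj2 (hPYUZ _)) mulr1.
have EUZ : (fun u z => \sum_x \sum_y joint_UXYZ PXZ PUX PYUZ u x y z) = joint_UZ PXZ PUX.
  apply/funext => u; apply/funext => z; apply: eq_bigr => x _.
  by rewrite -mulr_sumr (proj2 (hPYUZ _)) mulr1.
have dpi := data_processing PXZ PUX hPXZ hPUX.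
move: hR dpi; rewrite EXU EUZ.
set IX := mutual_info (joint_XU PXZ PUX); set IZ := mutual_info (joint_UZ PXZ PUX).
move=> hR dpi eps eps0.
have hXU := pmf_XU PXZ PUX hPXZ hPUX; have hUZ := pmf_UZ PXZ PUX hPXZ hPUX.
(* The rate slack [4 * d] is then [eps / 2]; the other half absorbs rounding. *)
have [d dE] : exists d, d = eps / 8 by exists (eps / 8).
have d0 : 0 < d by rewrite dE divr_gt0.
pose C1 := info_variance (joint_XU PXZ PUX).
pose C2 := info_variance (joint_UZ PXZ PUX).
have C10 : 0 <= C1 by exact: info_variance_ge0.
have C20 : 0 <= C2 by exact: info_variance_ge0.
(* All error terms other than [s / 2] add up to at most [C / n]. *)
pose C := 2 * (C1 / d ^+ 2) + (2 * eps * d)^-1 + 2 * (C2 / d ^+ 2 + d^-1).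
have C0 : 0 <= C.
  have := divr_ge0 C10 (sqr_ge0 d); have := divr_ge0 C20 (sqr_ge0 d).
  have : 0 < d^-1 by rewrite invr_gt0.
  have : 0 < (2 * eps * d)^-1 by rewrite invr_gt0 !mulr_gt0.
  rewrite /C; lra.
(* From here on [C / n] and [1 / n] are both at most [eps / 2]. *)
exists (Num.truncn ((2 * C + 2) / eps)).+1 => n nN.
have n0 : (0 < n)%N by apply: leq_trans nN.
have nR : 0 < n%:R :> R by rewrite ltr0n.
have Cn : (2 * C + 2) / n%:R <= eps.
  rewrite ler_pdivrMr // [leRHS]mulrC -ler_pdivrMr //; apply: ltW.
  apply: lt_le_trans (_ : (Num.truncn ((2 * C + 2) / eps)).+1%:R <= _).
    by rewrite -truncn_le_nat.
  by rewrite ler_nat.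
(* The exponents of [M] and [L] add up to [IX + 2 * d], a margin [d] above the covering threshold,
   while that of [L] is [d] below the decoding threshold. Covering uses the lower bounds on [M.+1]
   and [L.+1]; packing counts only the [L] competitors. *)
pose M := Num.truncn (expR (n%:R * (IX - IZ + 4 * d))).
pose L := Num.truncn (expR (n%:R * (IZ - 2 * d))).
have Mlt : expR (n%:R * (IX - IZ + 4 * d)) < M.+1%:R by rewrite -truncn_le_nat.
have Llt : expR (n%:R * (IZ - 2 * d)) < L.+1%:R by rewrite -truncn_le_nat.
have Mle : M%:R <= expR (n%:R * (IX - IZ + 4 * d)) by rewrite truncn_le expR_ge0.
have Lle : L%:R <= expR (n%:R * (IZ - 2 * d)) by rewrite truncn_le expR_ge0.
have nd : expR (- (n%:R * d)) <= (n%:R * d)^-1 by apply: expRN_le_inv; rewrite mulr_gt0.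
have [E [D [hE hD err]]] := one_shot (@block _ _ _ n PXZ) (block PUX) (block_kernel PYUZ)
  (block_pmf _ hPXZ) (block_cpmf _ hPUX) (block_kernel_cpmf _ hPYUZ) (block_kernel W) M L
  eps (expR (n%:R * (IX + d))) (expR (n%:R * (IZ - d)))
  (block_kernel_cpmf _ hW) (joint_posterior_block _ _ _ _ hJ) eps0 (expR_ge0 _) (expR_gt0 _).
exists M.+1, E, D; split => //.
(* Data processing makes the exponential at least 1, so [M.+1] is at most twice it, and [ln 2 <= 1]
   costs only [1 / n] in rate. *)
- have a1 : 1 <= expR (n%:R * (IX - IZ + 4 * d)).
    by rewrite -[leLHS]expR0 ler_expR mulr_ge0 ?ler0n //; lra.
  have ln2 : ln (2 : R) <= 1 by have := @le_ln1Dx R 1; apply; lra.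
  have : ln (M.+1%:R : R) <= 1 + n%:R * (IX - IZ + 4 * d).
    apply: (@le_trans _ _ (ln (2 * expR (n%:R * (IX - IZ + 4 * d))))).
      rewrite ler_ln ?posrE ?ltr0n ?mulr_gt0 ?expR_gt0 // -natr1; lra.
    by rewrite lnM ?posrE ?expR_gt0 // expRK lerD2r.
  rewrite -(ler_pM2l (_ : 0 < n%:R^-1)) ?invr_gt0 // => h; apply: le_trans h _.
  rewrite mulrDr mulr1 mulKf ?gt_eqF //.
  have : n%:R^-1 <= eps / 2.
    have : 0 <= 2 * C / n%:R by rewrite divr_ge0 ?mulr_ge0 ?ler0n.
    move: Cn; rewrite mulrDl; lra.
  rewrite dE; lra.
- apply: le_trans err _.
  rewrite joint_XU_block joint_UZ_block.
  (* The marginals are rewritten as those of the block joints, to match the two tail bounds. *)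
  have -> : snd_marginal (@block _ _ _ n PXZ) = snd_marginal (block (joint_UZ PXZ PUX)).
    apply/funext => z; rewrite -joint_UZ_block snd_marginal_UZ //.
    exact: block_cpmf.
  have -> : fst_marginal (@block _ _ _ n PXZ) = fst_marginal (block (joint_XU PXZ PUX)).
    apply/funext => x; rewrite -joint_XU_block fst_marginal_XU //.
    exact: block_cpmf.
  have EU : snd_marginal (@block _ _ _ n (joint_XU PXZ PUX)) =
      fst_marginal (block (joint_UZ PXZ PUX)).
    by apply/funext => u; rewrite -joint_UZ_block fst_marginal_UZ joint_XU_block.
  rewrite {2}EU.
  have h1 := block_upper_tail _ hXU n d n0 d0.
  have h2 := block_lower_tail _ hUZ n d n0 d0.
  have h3 : expR (n%:R * (IX + d)) / (2 * eps * (M.+1%:R * L.+1%:R)) <=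
      (2 * eps * d)^-1 / n%:R.
    have e : expR (n%:R * (IX + d)) = expR (n%:R * (IX - IZ + 4 * d)) *
        expR (n%:R * (IZ - 2 * d)) * expR (- (n%:R * d)).
      by rewrite -!expRD; congr expR; ring.
    have le1 : expR (n%:R * (IX - IZ + 4 * d)) * expR (n%:R * (IZ - 2 * d)) <=
        M.+1%:R * L.+1%:R by apply: ler_pM; rewrite ?expR_ge0 // ltW.
    rewrite ler_pdivrMr ?mulr_gt0 ?ltr0n // e.
    apply: le_trans (ler_pM _ _ le1 nd) _; rewrite ?mulr_ge0 ?expR_ge0 //.
    rewrite le_eqVlt; apply/orP; left; apply/eqP; field.
    by rewrite !gt_eqF.
  have h4 : L%:R / expR (n%:R * (IZ - d)) <= d^-1 / n%:R.
    rewrite ler_pdivrMr ?expR_gt0 //; apply: le_trans Lle _.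
    have -> : expR (n%:R * (IZ - 2 * d)) = expR (- (n%:R * d)) * expR (n%:R * (IZ - d)).
      by rewrite -expRD; congr expR; ring.
    rewrite ler_pM2r ?expR_gt0 //; apply: le_trans nd _.
    by rewrite invfM mulrC.
  have e1 : C / n%:R = 2 * (C1 / (n%:R * d ^+ 2)) + (2 * eps * d)^-1 / n%:R
      + 2 * (C2 / (n%:R * d ^+ 2) + d^-1 / n%:R).
    by rewrite /C; field; rewrite !gt_eqF.
  have : C / n%:R <= eps / 2.
    have : 0 <= n%:R^-1 :> R by rewrite invr_ge0 ler0n.
    move: Cn; rewrite mulrDl -mulrA; lra.
  move: h1 h2; rewrite -/C1 -/C2 -/IX -/IZ.
  set S1 := \sum_s _; set S2 := \sum_s _ => h1 h2 h5.
  apply: (@le_trans _ _ (2 * S1 + (eps / 2 + (2 * eps * d)^-1 / n%:R) + 2 * (S2 + d^-1 / n%:R))).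
    by rewrite lerD ?lerD2l ?ler_pM2l ?lerD2l.
  move: h5; rewrite e1; lra.
Qed.
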